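(* Let $R$ be a $\mathbb{Q}$-domain, $n=2$, and let $D\in\mathrm{LND}_R R[x_1,x_2]$ be affine and such that $\psi^{-1}\circ D\circ\psi$ is not triangular for any $\psi\in\mathrm{Aff}(R,\mathbf{x})$. Then for $f\in\ker D$, $\exp fD\in\mathrm{T}(R,\mathbf{x})$ if and only if $f\in R$.
   Context: $D$ is affine if $\deg D(x_i)\le1$ for all $i$, triangular if $D(x_i)\in R[x_1,\dots,x_{i-1}]$ for all $i$. $\mathrm{LND}_R$ denotes locally nilpotent $R$-derivations; $\exp D(f)=\sum_l D^l(f)/l!$. $\mathrm{Aff}(R,\mathbf{x})$ and $\mathrm{T}(R,\mathbf{x})$ are the subgroups of $\mathrm{Aut}(R[\mathbf{x}]/R)$ generated by affine automorphisms ($\deg\phi(x_i)=1$), resp. by affine and elementary automorphisms (fixing all variables but one). *)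

(* Defs.v *)
From HB Require Import structures.
From mathcomp Require Import all_boot all_order all_algebra.
From mathcomp Require Import mpoly.
From Stdlib Require Import ClassicalEpsilon.
Set Implicit Arguments. Unset Strict Implicit. Unset Printing Implicit Defensive.
Import Order.TTheory GRing.Theory Num.Theory.
Local Open Scope ring_scope.

(* Polynomial ring R[x_1,...,x_n] is {mpoly R[n]}; variable x_{i+1} is 'X_i
   with i : 'I_n (0-based indices). *)

(* R is a Q-domain: an integral domain containing Q, i.e. every positive
   integer is invertible in R. *)
Definition Qdomain (R : idomainType) : Prop :=
  forall k : nat, (k.+1)%:R \is a @GRing.unit R.

Definition is_Rderivation (R : idomainType) (n : nat)
  (D : {mpoly R[n]} -> {mpoly R[n]}) : Prop :=
  (forall (c : R) (p q : {mpoly R[n]}), D (c *: p + q) = c *: D p + D q) /\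
  (forall p q : {mpoly R[n]}, D (p * q) = p * D q + D p * q).

Definition locally_nilpotent (R : idomainType) (n : nat)
  (D : {mpoly R[n]} -> {mpoly R[n]}) : Prop :=
  forall p, exists k : nat, iter k D p = 0.

Definition is_LND (R : idomainType) (n : nat)
  (D : {mpoly R[n]} -> {mpoly R[n]}) : Prop :=
  is_Rderivation D /\ locally_nilpotent D.

(* affine: deg D(x_i) <= 1 for all i  (msize p = total degree + 1, msize 0 = 0) *)
Definition affine_der (R : idomainType) (n : nat)
  (D : {mpoly R[n]} -> {mpoly R[n]}) : Prop :=
  forall i : 'I_n, (msize (D 'X_i) <= 2)%N.

(* triangular: D(x_i) in R[x_1,...,x_{i-1}], i.e. every monomial of D(x_i)
   only involves variables of (0-based) index < i. *)
Definition triangular_der (R : idomainType) (n : nat)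
  (D : {mpoly R[n]} -> {mpoly R[n]}) : Prop :=
  forall (i j : 'I_n), (i <= j)%N ->
    forall m, m \in msupp (D 'X_i) -> m j = 0%N.

Definition is_Raut (R : idomainType) (n : nat)
  (phi : {mpoly R[n]} -> {mpoly R[n]}) : Prop :=
  [/\ (forall (c : R) (p q : {mpoly R[n]}), phi (c *: p + q) = c *: phi p + phi q),
      (forall p q, phi (p * q) = phi p * phi q),
      phi 1 = 1 & bijective phi].

Definition affine_aut (R : idomainType) (n : nat)
  (phi : {mpoly R[n]} -> {mpoly R[n]}) : Prop :=
  is_Raut phi /\ forall i : 'I_n, msize (phi 'X_i) = 2%N.

Definition elementary_aut (R : idomainType) (n : nat)
  (phi : {mpoly R[n]} -> {mpoly R[n]}) : Prop :=
  is_Raut phi /\ exists i : 'I_n, forall j : 'I_n, j != i -> phi 'X_j = 'X_j.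

Inductive gen_group (R : idomainType) (n : nat)
  (S : ({mpoly R[n]} -> {mpoly R[n]}) -> Prop) :
  ({mpoly R[n]} -> {mpoly R[n]}) -> Prop :=
| gen_id : gen_group S id
| gen_mul phi psi : S phi -> gen_group S psi -> gen_group S (phi \o psi)
| gen_inv phi phi' psi : S phi -> cancel phi phi' -> cancel phi' phi ->
    gen_group S psi -> gen_group S (phi' \o psi)
| gen_ext phi psi : gen_group S phi -> phi =1 psi -> gen_group S psi.

Definition Aff (R : idomainType) (n : nat) := gen_group (@affine_aut R n).

Definition Tame (R : idomainType) (n : nat) :=
  gen_group (fun phi => @affine_aut R n phi \/ @elementary_aut R n phi).

(* a nilpotency index of p for D (meaningful when D is locally nilpotent) *)
Definition nil_index (R : idomainType) (n : nat)
  (D : {mpoly R[n]} -> {mpoly R[n]}) (p : {mpoly R[n]}) : nat :=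
  epsilon (inhabits 0%N) (fun k => iter k D p = 0).

Definition expD (R : idomainType) (n : nat)
  (D : {mpoly R[n]} -> {mpoly R[n]}) (p : {mpoly R[n]}) : {mpoly R[n]} :=
  \sum_(l < nil_index D p) ((l`!)%:R)^-1 *: iter l D p.

Definition scale_der (R : idomainType) (n : nat)
  (f : {mpoly R[n]}) (D : {mpoly R[n]} -> {mpoly R[n]}) :=
  fun p => f * D p.

(* Main.v *)
Require Import Defs.
From HB Require Import structures.
From mathcomp Require Import all_boot all_order all_algebra.
From mathcomp Require Import mpoly ring zify.
From Stdlib Require Import ClassicalEpsilon.
Import GRing.Theory.
Local Open Scope ring_scope.
Set Implicit Arguments.
Unset Strict Implicit.
Unset Printing Implicit Defensive.

(* Affine and elementary automorphisms act on the pair of images of the variables, and a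
   tame pair (F, G) has a reduced form: up to an affine map over R it is either the pair
   of variables or of the shape (F', H + s(F')) with deg H <= deg F' and deg s >= 2. Hence
   a tame automorphism with an image of degree > 1 admits an invertible R-linear change of
   the two images in which one of them has degree smaller than the maximum. For exp(fD)
   with D x = A x + b, where tr A = det A = 0, and f non-constant in ker D, the leading
   forms of the images are those of f D x_i if A b = 0 and of f^2 D^2 x_i / 2 otherwise
   (then deg f >= 2, because ker D contains no affine form). In both cases the drop of
   degree yields the first row (u, v) of an invertible matrix over R with (u, v) A = 0,
   and D is triangular in the corresponding coordinates. *)

(** * Algebra endomorphisms and the chain rule *)

Section AlgebraMaps.

Variables (R : idomainType) (n : nat).
Implicit Types (phi : {mpoly R[n]} -> {mpoly R[n]}) (p q : {mpoly R[n]}).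

Definition alg_map phi : Prop :=
  [/\ forall c p q, phi (c *: p + q) = c *: phi p + phi q,
      forall p q, phi (p * q) = phi p * phi q & phi 1 = 1].

Lemma Raut_alg_map phi : is_Raut phi -> alg_map phi.
Proof. by case. Qed.

Lemma alg_map_comp phi psi : alg_map phi -> alg_map psi -> alg_map (phi \o psi).
Proof.
move=> [aL aM a1] [bL bM b1]; split=> [c p q | p q |] /=.
- by rewrite bL aL.
- by rewrite bM aM.
- by rewrite b1 a1.
Qed.

Lemma alg_map_cancel phi phi' :
  alg_map phi -> cancel phi phi' -> cancel phi' phi -> alg_map phi'.
Proof.
move=> [aL aM a1] K K'; split=> [c p q | p q |]; apply: (can_inj K).
- by rewrite aL !K'.
- by rewrite aM !K'.
- by rewrite a1 K'.
Qed.

(** With this induction, identities compatible with the algebra operations need only be checked on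
    the variables. *)
Lemma mpoly_alg_ind (P : {mpoly R[n]} -> Prop) :
  P 1 -> (forall i, P 'X_i) ->
  (forall c p q, P p -> P q -> P (c *: p + q)) ->
  (forall p q, P p -> P q -> P (p * q)) -> forall p, P p.
Proof.
move=> P1 PX PL PM.
have P0 : P 0 by rewrite -(addNr 1) -scaleN1r; apply: PL.
apply: mpolyind => // c m p _ _ Pp; apply: PL => //.
rewrite mpolyXE_id; apply: big_ind => // i _.
by elim: (m i) => [|k IH]; rewrite ?expr0 // exprS; apply: PM.
Qed.

Lemma mderivXU i j : mderiv j ('X_i : {mpoly R[n]}) = (i == j)%:R.
Proof.
rewrite mderivX mnm1E; case: eqP => [-> | _]; last by rewrite scale0r.
by rewrite -[X in (X - _)%MM]add0m addmK mpolyX0 scale1r.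
Qed.

Section Theory.

Variable phi : {mpoly R[n]} -> {mpoly R[n]}.
Hypothesis phiA : alg_map phi.

Lemma alg_mapD p q : phi (p + q) = phi p + phi q.
Proof. by case: phiA => L _ _; rewrite -[p]scale1r L !scale1r. Qed.

Lemma alg_map0 : phi 0 = 0.
Proof. by apply: (addrI (phi 0)); rewrite -alg_mapD !addr0. Qed.

Lemma alg_mapZ c p : phi (c *: p) = c *: phi p.
Proof. by case: (phiA) => L _ _; rewrite -[c *: p]addr0 L alg_map0 addr0. Qed.

Lemma alg_mapC c : phi c%:MP = c%:MP.
Proof.
by case: (phiA) => _ _ one; rewrite -[c]mulr1 -[LHS]/(phi (c * 1)%:MP)
  mpolyCM mul_mpolyC alg_mapZ one -mul_mpolyC.
Qed.

Lemma alg_map_horner (s : {poly R}) p :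
  phi (horner_alg p s) = horner_alg (phi p) s.
Proof.
case: (phiA) => _ M one; elim/poly_ind: s => [|s c IH].
  by rewrite !rmorph0 alg_map0.
by rewrite !(rmorphD, rmorphM) /= !horner_algX !horner_algC alg_mapD M IH alg_mapZ one.
Qed.

Lemma mderiv_alg_map j p :
  mderiv j (phi p) = \sum_i phi (mderiv i p) * mderiv j (phi 'X_i).
Proof.
case: (phiA) => L M one; elim/mpoly_alg_ind: p => [|i|c p q IHp IHq|p q IHp IHq].
- rewrite one -mpolyC1 mderivC big1 // => i _.
  by rewrite mderivC alg_map0 mul0r.
- rewrite (bigD1 i) //= mderivXU eqxx one mul1r big1 ?addr0 // => k ki.
  by rewrite mderivXU eq_sym (negPf ki) alg_map0 mul0r.
- rewrite L mderivD mderivZ IHp IHq scaler_sumr -big_split /=; apply: eq_bigr => i _.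
  by rewrite mderivD mderivZ L mulrDl scalerAl.
- rewrite M mderivM IHp IHq mulr_suml mulr_sumr -big_split /=.
  by apply: eq_bigr => i _; rewrite mderivM alg_mapD !M; ring.
Qed.

End Theory.

Lemma alg_map_eq phi psi : alg_map phi -> alg_map psi ->
  (forall i, phi 'X_i = psi 'X_i) -> phi =1 psi.
Proof.
move=> [aL aM a1] [bL bM b1] E; elim/mpoly_alg_ind => [|i|c p q Hp Hq|p q Hp Hq].
- by rewrite a1 b1.
- exact: E.
- by rewrite aL bL Hp Hq.
- by rewrite aM bM Hp Hq.
Qed.

End AlgebraMaps.

(** * Degrees *)

Section Degree.

Variables (R : idomainType) (n : nat).
Implicit Types p q : {mpoly R[n]}.

Lemma msizeD_small p q : (msize q < msize p)%N -> msize (p + q) = msize p.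
Proof.
move=> lt_qp; apply/eqP; rewrite eqn_leq; apply/andP; split.
  by apply: leq_trans (msizeD_le _ _) _; rewrite geq_max leqnn ltnW.
have := msizeD_le (p + q) (- q).
by rewrite addrK msizeN leq_max [(_ <= msize q)%N]leqNgt lt_qp orbF.
Qed.

(** Over a domain each Horner step multiplies by the nonconstant [p], which raises the degree, so
    the constant added afterwards cannot touch the leading form. *)
Lemma msize_horner_alg p (s : {poly R}) : (2 <= msize p)%N -> s != 0 ->
  msize (horner_alg p s) = ((size s).-1 * (msize p).-1).+1.
Proof.
move=> p_ge2; have p0 : p != 0 by rewrite -msize_poly_eq0; lia.
elim/poly_ind: s => [|s c IH]; first by rewrite eqxx.
have [-> | s0 _] := eqVneq s 0.
  rewrite mul0r add0r polyC_eq0 => c0.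
  by rewrite horner_algC size_polyC c0 -mul_mpolyC mulr1 msizeC c0.
rewrite rmorphD rmorphM /= horner_algX horner_algC -mul_mpolyC mulr1.
rewrite size_MXaddC (negPf s0) /=.
have sp : msize (horner_alg p s * p) = ((size s) * (msize p).-1).+1.
  have h0 : horner_alg p s != 0 by rewrite -msize_poly_eq0 IH.
  rewrite msizeM // IH // -[size s in RHS](@prednK (size s)) ?size_poly_gt0 //; lia.
rewrite msizeD_small ?sp // msizeC.
have := size_poly_gt0 s; rewrite s0.
by case: (c != 0) => /=; nia.
Qed.

Lemma msize_le2E p : (msize p <= 2)%N ->
  p = (p@_0)%:MP + \sum_i p@_(U_(i)) *: 'X_i.
Proof.
move=> sp; apply/mpolyP => m; rewrite mcoeffD mcoeffC raddf_sum /=.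
under eq_bigr => i _ do rewrite mcoeffZ mcoeffX.
have [m0 | m2 | /eqP/mdeg1P [i /eqP ->]] := ltngtP (mdeg m) 1.
- have /eqP -> : m == 0%MM by rewrite -mdeg_eq0; lia.
  rewrite eqxx mulr1 big1 ?addr0 // => i _.
  by rewrite mnm1_eq0 mulr0.
- have -> : p@_m = 0 by apply/memN_msupp_eq0/msize_mdeg_ge; lia.
  have -> : (m == 0%MM) = false by apply/eqP => E; rewrite E mdeg0 in m2.
  rewrite mulr0 add0r big1 // => i _.
  by case: eqP m2 => [<-|]; rewrite ?mdeg1 ?mulr0.
- rewrite mnm1_eq0 mulr0 add0r (bigD1 i) //= eqxx mulr1 big1 ?addr0 //.
  by move=> j ji; rewrite eq_mnm1 (negPf ji) mulr0.
Qed.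

Lemma mpoly_unitP p q : p * q = 1 -> exists2 u, u \is a GRing.unit & q = u%:MP.
Proof.
move=> pq1.
have p0 : p != 0 by apply: contra_eq_neq pq1 => ->; rewrite mul0r eq_sym oner_eq0.
have q0 : q != 0 by apply: contra_eq_neq pq1 => ->; rewrite mulr0 eq_sym oner_eq0.
have := msizeM p0 q0; rewrite pq1 msize1 => E.
have /msize1_polyC qE : (msize q <= 1)%N.
  by move: p0 q0; rewrite -!msize_poly_eq0; lia.
exists q@_0 => //; apply/unitrP; exists p@_0; rewrite [_ * p@_0]mulrC.
suff -> : p@_0 * q@_0 = 1 by [].
by move: pq1; rewrite qE mulrC mul_mpolyC => /mpolyP/(_ 0%MM);
  rewrite mcoeffZ mcoeff1 eqxx mcoeffC eqxx mulr1 mulrC.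
Qed.

(** Constants are fixed by [phi], so by injectivity a variable with constant image would itself be
    constant. *)
Lemma msize_Raut (phi : {mpoly R[n]} -> {mpoly R[n]}) i :
  is_Raut phi -> (2 <= msize (phi 'X_i))%N.
Proof.
move=> autphi; have phiA := Raut_alg_map autphi; rewrite ltnNge; apply/negP => le1.
case: autphi => _ _ _ /bij_inj inj_phi.
have /inj_phi E : phi 'X_i = phi ((phi 'X_i)@_0)%:MP.
  by rewrite (alg_mapC phiA); apply: msize1_polyC.
have := msizeX R U_(i); rewrite E msizeC mdeg1.
by case: (_ != 0).
Qed.

End Degree.

(** * Reduced words *)

Section AffinePairs.

Variable R : idomainType.
Local Notation P := {mpoly R[2]}.

Definition lin (a b c : R) (F G : P) : P := a *: F + b *: G + c%:MP.

(** The witness [w] inverts the determinant, so the change of pair lies in the affine group over [R]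
    itself, not over its fraction field. *)
Definition aff_equiv (F G : P * P) : Prop :=
  exists a b c d e g w : R, w * (a * d - b * c) = 1 /\
    F = (lin a b e G.1 G.2, lin c d g G.1 G.2).

(* The [ring] tactic only rewrites with equations whose left-hand side is a monomial. *)
Lemma det_monomial (A : comPzRingType) (w a b c d : A) :
  w * (a * d - b * c) = 1 -> w * a * d = 1 + w * b * c.
Proof. by move=> H; rewrite -H; ring. Qed.

Lemma aff_equiv_refl F : aff_equiv F F.
Proof.
exists 1, 0, 0, 1, 0, 0, 1; split; first by ring.
by case: F => F G; rewrite /lin /= -!mul_mpolyC; congr pair; ring.
Qed.

Lemma aff_equiv_trans F G H : aff_equiv F G -> aff_equiv G H -> aff_equiv F H.
Proof.
move=> [a [b [c [d [e [g [w [Hw ->]]]]]]]] [a' [b' [c' [d' [e' [g' [w' [Hw' ->]]]]]]]].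
exists (a * a' + b * c'), (a * b' + b * d'), (c * a' + d * c'), (c * b' + d * d'),
  (a * e' + b * g' + e), (c * e' + d * g' + g), (w * w').
have E := det_monomial Hw; have E' := det_monomial Hw'.
split; first by ring: E E'.
by rewrite /lin /= -!mul_mpolyC; congr pair; ring.
Qed.

Lemma aff_equiv_sym F G : aff_equiv F G -> aff_equiv G F.
Proof.
move=> [a [b [c [d [e [g [w [Hw ->]]]]]]]].
(* The inverse matrix is [w] times the adjugate; its determinant is [w], whose inverse is
   [a * d - b * c]. *)
exists (w * d), (- w * b), (- w * c), (w * a), (w * (b * g - d * e)),
  (w * (c * e - a * g)), (a * d - b * c).
have E := det_monomial Hw.
have : (w * a * d)%:MP_[2] = (1 + w * b * c)%:MP by rewrite E.
rewrite !(mpolyCD, mpolyCM) => E'; split; first by ring: E.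
case: G => G H; rewrite /lin /= -!mul_mpolyC !(mpolyCB, mpolyCM, mpolyCN).
by congr pair; ring: E'.
Qed.

Lemma aff_equiv_swap F G : aff_equiv (F, G) (G, F).
Proof.
exists 0, 1, 1, 0, 0, 0, (-1); split; first by ring.
by rewrite /lin /= -!mul_mpolyC; congr pair; ring.
Qed.

Lemma msize_lin_le a b c F G N : (0 < N)%N -> (msize F <= N)%N -> (msize G <= N)%N ->
  (msize (lin a b c F G) <= N)%N.
Proof.
move=> N0 FN GN; rewrite /lin.
apply: leq_trans (msizeD_le _ _) _; rewrite geq_max; apply/andP; split; last first.
  by rewrite msizeC; case: (c != 0).
apply: leq_trans (msizeD_le _ _) _; rewrite geq_max; apply/andP; split.
  exact: leq_trans (msizeZ_le _ _) FN.
exact: leq_trans (msizeZ_le _ _) GN.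
Qed.

Lemma msize_lin a b c F G : b != 0 -> (1 < msize G)%N -> (msize F < msize G)%N ->
  msize (lin a b c F G) = msize G.
Proof.
move=> b0 G1 FG.
have -> : lin a b c F G = b *: G + lin a 0 c F G by rewrite /lin scale0r; ring.
rewrite msizeD_small msizeZ //.
rewrite /lin scale0r addr0; apply: leq_ltn_trans (msizeD_le _ _) _.
rewrite gtn_max msizeC; apply/andP; split; last by case: (c != 0) => //; lia.
exact: leq_ltn_trans (msizeZ_le _ _) FG.
Qed.

(* Normal forms of tame pairs modulo affine maps on the left: since [s] has degree at
   least 2 and [H] has degree at most that of [F], every step raises the degree of the
   second component, so no cancellation can occur. *)
Inductive reduced : P * P -> Prop :=
| reduced_id : reduced ('X_ord0, 'X_ord_max)
| reduced_step G F H (s : {poly R}) : reduced G -> aff_equiv (F, H) G ->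
    (2 <= msize F)%N -> (msize H <= msize F)%N -> (3 <= size s)%N ->
    reduced (F, H + horner_alg F s).

Definition reducible F := exists2 G, reduced G & aff_equiv F G.

Lemma reducible_aff F G : aff_equiv F G -> reducible G -> reducible F.
Proof. by move=> FG [H rH GH]; exists H => //; apply: aff_equiv_trans FG GH. Qed.

Lemma horner_alg_le2 (F : P) (s : {poly R}) : (size s <= 2)%N ->
  horner_alg F s = s`_1 *: F + (s`_0)%:MP.
Proof.
move=> s2; have -> : s = (s`_1)%:P * 'X + (s`_0)%:P.
  apply/polyP => -[|[|i]]; rewrite coefD coefMX !coefC ?addr0 ?add0r //=.
  by apply: nth_default; apply: leq_trans s2 _.
rewrite rmorphD rmorphM /= horner_algX !horner_algC -!mul_mpolyC !mulr1.
by rewrite !coefD !coefMX !coefC /= addr0 add0r.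
Qed.

Lemma aff_equiv_shear F H a b : aff_equiv (F, H + (a *: F + b%:MP)) (F, H).
Proof.
exists 1, 0, a, 1, 0, b, 1; split; first by ring.
by rewrite /lin /= -!mul_mpolyC; congr pair; ring.
Qed.

(** As [s] has degree at least 2 and [F] is nonconstant, [s(F)] has larger degree than [F], hence
    than [H], and dominates the second component. *)
Lemma reduced_msize (G : P * P) : reduced G ->
  [/\ (2 <= msize G.1)%N, (2 <= msize G.2)%N & 
      G = ('X_ord0 : P, 'X_ord_max : P) \/ (msize G.1 < msize G.2)%N].
Proof.
case=> [|{G}G F H s _ _ F2 HF s3]; first by rewrite !msizeX !mdeg1; split => //; left.
have s0 : s != 0 by rewrite -size_poly_gt0; apply: leq_trans s3.
have lt : (msize F < msize (horner_alg F s))%N.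
  by rewrite msize_horner_alg //; move: (size _) (msize F) s3 F2 => k l k3 l2; nia.
rewrite /= addrC msizeD_small; last exact: leq_ltn_trans HF lt.
by split; [| apply: leq_trans (ltnW lt) | right].
Qed.

Lemma horner_alg_comp (F : P) (s q : {poly R}) :
  horner_alg F (s \Po q) = horner_alg (horner_alg F q) s.
Proof.
elim/poly_ind: s => [|s c IH]; first by rewrite comp_poly0 !rmorph0.
rewrite comp_polyD comp_polyM comp_polyX comp_polyC !(rmorphD, rmorphM) /= IH.
by rewrite !horner_algC horner_algX.
Qed.

(** A shear of degree at most 1 is absorbed by the affine group. Otherwise it becomes a new step of
    the normal form when [F] has maximal degree in the pair, and merges with the last step when it
    does not. *)
Lemma reducible_step (F H : P) (s : {poly R}) :
  reducible (F, H) -> reducible (F, H + horner_alg F s).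
Proof.
move=> rFH.
have [s2 | s3] := leqP (size s) 2.
  by apply: reducible_aff rFH; rewrite horner_alg_le2 //; apply: aff_equiv_shear.
case: (rFH) => G rG FG.
have [G1 G2 Gcase] := reduced_msize rG.
have main : (2 <= msize F)%N -> (msize H <= msize F)%N ->
    reducible (F, H + horner_alg F s).
  move=> F2 HF; exists (F, H + horner_alg F s); last exact: aff_equiv_refl.
  exact: reduced_step rG FG F2 HF s3.
have [a [b [c [d [e [g [w [Hw [EF EH]]]]]]]]] := FG.
case: Gcase => [EG | lt12].
  have F2 : (2 <= msize F)%N.
    (* A constant [F] would make the row [(a, b)] zero, against the invertible determinant. *)
    rewrite ltnNge; apply/negP => F1.
    have /mpolyP := msize1_polyC F1; rewrite EF EG /lin /= => E.
    have a0 : a = 0.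
      move: (E U_(ord0)%MM).
      by rewrite !mcoeffD !mcoeffZ !mcoeffXU !mcoeffC !mnm1_eq0 /= !mulr0 mulr1 !addr0.
    have b0 : b = 0.
      move: (E U_(ord_max)%MM).
      by rewrite !mcoeffD !mcoeffZ !mcoeffXU !mcoeffC !mnm1_eq0 /= !mulr0 mulr1 !addr0 add0r.
    by move/eqP: Hw; rewrite a0 b0 !mul0r subrr mulr0 eq_sym oner_eq0.
  apply: main => //; apply: leq_trans F2.
  by rewrite EH EG; apply: msize_lin_le; rewrite ?msizeX ?mdeg1.
(* If [b] is nonzero, [F] inherits the larger degree, that of the second component of [G], and the
   new step is legitimate. *)
have [b0 | b0] := eqVneq b 0; last first.
  apply: main; rewrite EF msize_lin //.
  by rewrite EH msize_lin_le // ltnW // ltnW.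
move: rG G1 G2 lt12 EF EH FG => [|{G}G K L t rG KG K2 LK t3].
  by rewrite !msizeX !mdeg1.
move=> /= _ _ _ EF EH FG.
(* [F] is an affine function of [K], so the two steps merge into one. *)
pose q := t + (w * a) *: (s \Po (a *: 'X + e%:P)).
have EK : horner_alg K (a *: 'X + e%:P) = F.
  rewrite rmorphD /= linearZ /= horner_algX horner_algC -[e *: 1]mul_mpolyC mulr1.
  by rewrite mulr_algl EF b0 /lin scale0r addr0.
have Eq : horner_alg K q = horner_alg K t + (w * a) *: horner_alg F s.
  by rewrite rmorphD /= linearZ /= mulr_algl horner_alg_comp EK.
(* Now [w * a] is the inverse of [d], the coefficient of the second component in [H]; hence the
   factor in [q]. *)
have E : (w * a * d)%:MP_[2] = 1 by rewrite (det_monomial Hw) b0 mulr0 mul0r addr0 mpolyC1.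
apply: (@reducible_aff _ (K, L + horner_alg K q)).
  exists a, b, c, d, e, g, w; split=> //; congr pair.
    by rewrite /= EF b0 /lin !scale0r.
  rewrite /= EH Eq /lin -!mul_mpolyC; rewrite !mpolyCM in E *.
  by ring: E.
(* The sum [q] may lose degree; if at most 1 is left, the last step disappears and [G] remains. *)
have [q2 | q3] := leqP (size q) 2.
  rewrite horner_alg_le2 //; apply: reducible_aff (aff_equiv_shear _ _ _ _) _.
  by exists G.
by exists (K, L + horner_alg K q); [exact: reduced_step rG KG K2 LK q3 | exact: aff_equiv_refl].
Qed.

End AffinePairs.

(** * Tame automorphisms *)

Section Tame.

Variable R : idomainType.
Hypothesis HQ : Qdomain R.
Local Notation P := {mpoly R[2]}.
Local Notation x0 := ('X_ord0 : P).
Local Notation x1 := ('X_ord_max : P).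
Implicit Types (phi chi : P -> P).

Lemma ord2P (i : 'I_2) : i = ord0 \/ i = ord_max.
Proof.
by case: i => [[|[|m]] lt_m]; [left | right |]; try exact: val_inj.
Qed.

Lemma big_ord2 (V : nmodType) (F : 'I_2 -> V) : \sum_i F i = F ord0 + F ord_max.
Proof. by rewrite big_ord_recl big_ord1; congr (_ + F _); apply: val_inj. Qed.

Lemma alg_map_lin chi a b c F G : alg_map chi ->
  chi (lin a b c F G) = lin a b c (chi F) (chi G).
Proof. by move=> chiA; rewrite /lin !(alg_mapD chiA) !(alg_mapZ chiA) (alg_mapC chiA). Qed.

Lemma alg_map_aff_equiv chi F G F' G' : alg_map chi ->
  aff_equiv (F, G) (F', G') -> aff_equiv (chi F, chi G) (chi F', chi G').
Proof.
move=> chiA [a [b [c [d [e [g [w [Hw [-> ->]]]]]]]]].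
by exists a, b, c, d, e, g, w; split; rewrite //= !alg_map_lin.
Qed.

(** By the chain rule for [phi (phi' 'X_i)], the product of two Jacobian matrices is the identity;
    determinants are then compared. *)
Lemma jacobian_unit phi : alg_map phi -> bijective phi ->
  exists w, w * (mderiv ord0 (phi x0) * mderiv ord_max (phi x1)
               - mderiv ord0 (phi x1) * mderiv ord_max (phi x0)) = 1.
Proof.
move=> phiA [phi' K K'].
have chain i j : phi (mderiv ord0 (phi' 'X_i)) * mderiv j (phi x0)
    + phi (mderiv ord_max (phi' 'X_i)) * mderiv j (phi x1) = (i == j)%:R.
  have := mderiv_alg_map phiA j (phi' 'X_i); rewrite K' big_ord2 => <-.
  exact: mderivXU.
have [E00 E01] := (chain ord0 ord0, chain ord0 ord_max).
have [E10 E11] := (chain ord_max ord0, chain ord_max ord_max).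
move: E00 E01 E10 E11.
set a := phi (mderiv ord0 (phi' x0)); set b := phi (mderiv ord_max (phi' x0)).
set c := phi (mderiv ord0 (phi' x1)); set d := phi (mderiv ord_max (phi' x1)).
set p := mderiv ord0 (phi x0); set q := mderiv ord0 (phi x1).
set r := mderiv ord_max (phi x0); set s := mderiv ord_max (phi x1) => E00 E01 E10 E11.
exists (a * d - b * c).
transitivity ((a * p + b * q) * (c * r + d * s) - (a * r + b * s) * (c * p + d * q)).
  by ring.
by rewrite E00 E01 E10 E11 /=; ring.
Qed.

Lemma lin_le2E (p : P) : (msize p <= 2)%N -> exists a b c, p = lin a b c x0 x1.
Proof.
move=> /msize_le2E pE; exists p@_(U_(ord0)), p@_(U_(ord_max)), p@_0%MM.
by rewrite {1}pE big_ord2 [LHS]addrC.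
Qed.

Lemma affine_aut_equiv phi : affine_aut phi -> aff_equiv (phi x0, phi x1) (x0, x1).
Proof.
move=> [autphi sz]; have phiA := Raut_alg_map autphi.
case: autphi => _ _ _ bij; have [w] := jacobian_unit phiA bij.
have E0 : (msize (phi x0) <= 2)%N by rewrite sz.
have E1 : (msize (phi x1) <= 2)%N by rewrite sz.
have [[a [b [e ->]]] [c [d [g ->]]]] := (lin_le2E E0, lin_le2E E1).
have der i u v z : mderiv i (lin u v z x0 x1) = (u *+ (ord0 == i) + v *+ (ord_max == i))%:MP.
  rewrite /lin !mderivD !mderivZ mderivC addr0 !mderivXU mpolyCD.
  by rewrite -!mul_mpolyC; case: (_ == _); case: (_ == _); rewrite /= !(mulr0, mulr1, mpolyC0).
rewrite !der /= !(mulr0n, mulr1n, addr0, add0r) -!mpolyCM -mpolyCB => /mpoly_unitP.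
move=> [u uU /(congr1 (mcoeff 0%MM))]; rewrite !mcoeffC eqxx !mulr1 => E.
exists a, b, c, d, e, g, u^-1; split=> //.
by rewrite [b * c]mulrC E mulVr.
Qed.

(** Positive integers are units in [R], so a monomial containing the variable [i] would survive in
    the derivative. *)
Lemma mderiv0_horner (i j : 'I_2) (p : P) : i != j -> mderiv i p = 0 ->
  exists s, p = horner_alg 'X_j s.
Proof.
move=> ij dp.
have supp m : p@_m != 0 -> m i = 0%N.
  move=> pm; apply/eqP; rewrite -leqn0 leqNgt; apply/negP => mi.
  have le1 : (U_(i) <= m)%MM.
    by apply/mnm_lepP => k; rewrite mnm1E; case: eqP => [<-|].
  have /eqP := congr1 (mcoeff (m - U_(i))) dp.
  rewrite mcoeff_mderiv submK // mcoeff0 -mulr_natr mulf_eq0 (negPf pm) /=.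
  by apply/negP; apply: contraTneq (HQ ((m - U_(i))%MM i)) => ->; rewrite unitr0.
exists (\poly_(k < msize p) p@_(U_(j) *+ k)).
rewrite poly_def rmorph_sum /=.
under eq_bigr => k _ do rewrite linearZ /= rmorphXn /= horner_algX mulr_algl.
apply/mpolyP => m; rewrite raddf_sum /=.
have [pm0 | pm] := eqVneq p@_m 0.
  rewrite pm0 big1 // => k _; rewrite mcoeffZ mpolyXn mcoeffX.
  by case: eqP => [->|]; rewrite ?pm0 ?mul0r ?mulr0.
have mE : m = (U_(j) *+ m j)%MM.
  apply/mnmP => k; rewrite mulmnE mnm1E.
  have [<-|jk] := eqVneq j k; first by rewrite mul1n.
  suff -> : k = i by rewrite supp.
  by case: (ord2P i) (ord2P j) (ord2P k) ij jk => -> [] -> [] ->.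
have lt : (m j < msize p)%N.
  rewrite ltnNge; apply: contraNN pm => le; apply/eqP/memN_msupp_eq0/msize_mdeg_ge.
  by rewrite mE mdegMn mdeg1 mul1n.
rewrite (bigD1 (Ordinal lt)) //= -mE mcoeffZ mpolyXn -mE mcoeffX eqxx mulr1.
rewrite big1 ?addr0 // => k; rewrite -val_eqE /= => kn.
rewrite mcoeffZ mpolyXn mcoeffX; case: eqP => [E|]; last by rewrite mulr0.
by move: kn; rewrite -E mulmnE mnm1E eqxx mul1n eqxx.
Qed.

(** The Jacobian matrix is triangular with one diagonal entry 1, so the derivative of [phi 'X_i]
    along [i] is a unit constant [u]; removing [u *: 'X_i] leaves a polynomial in the other
    variable. *)
Lemma elementary_autE phi : elementary_aut phi ->
  exists i j u s, [/\ i != j, phi 'X_j = 'X_j, u \is a GRing.unit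
    & phi 'X_i = u *: 'X_i + horner_alg 'X_j s].
Proof.
move=> [autphi [i fix_phi]]; have phiA := Raut_alg_map autphi.
have [j ij] : exists j : 'I_2, i != j.
  by case: (ord2P i) => ->; [exists ord_max | exists ord0].
have fix_j : phi 'X_j = 'X_j by apply: fix_phi; rewrite eq_sym.
have [w Ew] : exists w, w * mderiv i (phi 'X_i) = 1.
  case: autphi => _ _ _ bij; have [w] := jacobian_unit phiA bij.
  case: (ord2P i) (ord2P j) ij fix_j => -> [] -> //= _ ->;
    rewrite !mderivXU /= !(mulr0, mulr1, mul1r, subr0, mul0r, sub0r) => <-.
    by exists w.
  by exists w.
have [u uU Eu] := mpoly_unitP Ew.
have d0 : mderiv i (phi 'X_i - u *: 'X_i) = 0.
  by rewrite mderivB mderivZ Eu mderivXU eqxx -mul_mpolyC mulr1 subrr.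
have [s Es] := mderiv0_horner ij d0.
by exists i, j, u, s; split=> //; rewrite -Es addrC subrK.
Qed.

Lemma reducible_swap (F H : P) : reducible (F, H) -> reducible (H, F).
Proof. by apply: reducible_aff; apply: aff_equiv_swap. Qed.

Lemma reducible_scaled_step (F H : P) u (s : {poly R}) : u \is a GRing.unit ->
  reducible (F, H) -> reducible (F, u *: H + horner_alg F s).
Proof.
move=> uU /(reducible_step (u^-1 *: s)); apply: reducible_aff.
exists 1, 0, 0, u, 0, 0, u^-1; split; first by rewrite mulr0 subr0 mul1r mulVr.
rewrite /lin /= linearZ /= mulr_algl !scale0r mpolyC0 !addr0 add0r scale1r.
by rewrite scalerDr scalerA mulrV // scale1r.
Qed.

Lemma reducible_elementary chi phi : alg_map chi -> elementary_aut phi ->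
  reducible (chi x0, chi x1) -> reducible (chi (phi x0), chi (phi x1)).
Proof.
move=> chiA /elementary_autE [i [j [u [s [ij Ej uU Ei]]]]].
case: (ord2P i) (ord2P j) ij Ej Ei => -> [] -> //= _ -> ->.
  move=> /reducible_swap H; apply: reducible_swap.
  by rewrite (alg_mapD chiA) (alg_mapZ chiA) (alg_map_horner chiA); apply: reducible_scaled_step.
by rewrite (alg_mapD chiA) (alg_mapZ chiA) (alg_map_horner chiA); apply: reducible_scaled_step.
Qed.

Lemma elementary_aut_inv phi phi' : elementary_aut phi ->
  cancel phi phi' -> cancel phi' phi -> elementary_aut phi'.
Proof.
move=> [autphi [i fix_phi]] K K'; split; last first.
  by exists i => j ji; apply: (can_inj K); rewrite K' fix_phi.
have [L M one] := alg_map_cancel (Raut_alg_map autphi) K K'.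
by split=> //; exists phi.
Qed.

Lemma reducible_affine chi phi : alg_map chi -> affine_aut phi ->
  reducible (chi x0, chi x1) -> reducible (chi (phi x0), chi (phi x1)).
Proof.
move=> chiA /affine_aut_equiv E; apply: reducible_aff; exact: alg_map_aff_equiv.
Qed.

(** Applying [phi'] to the equivalence for [phi] and using symmetry avoids computing the degrees of
    [phi']. *)
Lemma reducible_affine_inv chi phi phi' : alg_map chi -> affine_aut phi ->
  cancel phi phi' -> cancel phi' phi ->
  reducible (chi x0, chi x1) -> reducible (chi (phi' x0), chi (phi' x1)).
Proof.
move=> chiA aff K K'; apply: reducible_aff; apply: alg_map_aff_equiv => //.
have [/Raut_alg_map phiA _] := aff; have phi'A := alg_map_cancel phiA K K'.
by have := alg_map_aff_equiv phi'A (affine_aut_equiv aff); rewrite !K => /aff_equiv_sym.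
Qed.

Lemma Tame_reducible phi : Tame phi -> reducible (phi x0, phi x1).
Proof.
(* Words grow by an outermost generator, whereas normal forms grow by an innermost one; the
   accumulator [chi] collects the letters already read. *)
suff main : Tame phi -> forall chi, alg_map chi -> reducible (chi x0, chi x1) ->
    reducible (chi (phi x0), chi (phi x1)).
  move=> tame_phi; apply: (main tame_phi id); first by split.
  by exists ('X_ord0, 'X_ord_max); [exact: reduced_id | exact: aff_equiv_refl].
elim=> {phi} [|phi psi gen_phi _ IH|phi phi' psi gen_phi K K' _ IH|phi psi _ IH E] chi chiA //.
- move=> red; have phiA : alg_map phi by case: gen_phi => -[] /Raut_alg_map.
  apply: (IH (chi \o phi)); first exact: alg_map_comp.
  by case: gen_phi => H;
    [exact: reducible_affine chiA H red | exact: reducible_elementary chiA H red].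
- move=> red; have phiA : alg_map phi by case: gen_phi => -[] /Raut_alg_map.
  apply: (IH (chi \o phi')); first exact: alg_map_comp chiA (alg_map_cancel phiA K K').
  case: gen_phi => H; first exact: reducible_affine_inv H K K' red.
  exact: reducible_elementary chiA (elementary_aut_inv H K K') red.
- by rewrite -!E; apply: IH.
Qed.

(** If the normal form is not the pair of variables, its first component is an invertible affine
    combination of the images and has smaller degree than the second, whose degree is at most their
    maximum. *)
Lemma Tame_degree phi : Tame phi ->
  (msize (phi x0) <= 2)%N /\ (msize (phi x1) <= 2)%N \/
  exists a b c d e w : R, w * (a * d - b * c) = 1 /\
    (msize (lin a b e (phi x0) (phi x1)) < maxn (msize (phi x0)) (msize (phi x1)))%N.
Proof.
move=> /Tame_reducible [[G1 G2] rG equivG].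
have [/= G1_ge2 G2_ge2 [[E1 E2] | lt12]] := reduced_msize rG.
  case: equivG => [a [b [c [d [e [g [w [_ [-> ->]]]]]]]]] /=; left.
  by rewrite E1 E2; split; apply: msize_lin_le; rewrite ?msizeX ?mdeg1.
right; have [a [b [c [d [e [g [w [Hw [E1 E2]]]]]]]]] := aff_equiv_sym equivG.
exists a, b, c, d, e, w; split=> //; rewrite -E1; apply: leq_trans lt12 _.
rewrite E2 /=; apply: msize_lin_le; rewrite ?leq_maxl ?leq_maxr //.
(* The bound on [lin] needs a positive maximum: otherwise [G2] would be constant. *)
rewrite leqNgt; apply/negP => lt1.
have : (msize G2 <= 1)%N.
  rewrite E2 /=; apply: msize_lin_le => //.
    by apply: leq_trans (leq_maxl _ _) (ltnW lt1).
  by apply: leq_trans (leq_maxr _ _) (ltnW lt1).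
by rewrite leqNgt G2_ge2.
Qed.

End Tame.

(** * Exponentials *)

Section Exponential.

Variables (R : idomainType) (n : nat).
Hypothesis HQ : Qdomain R.
Implicit Types (D : {mpoly R[n]} -> {mpoly R[n]}) (p q f : {mpoly R[n]}).

Section Derivation.

Variable D : {mpoly R[n]} -> {mpoly R[n]}.
Hypothesis derD : is_Rderivation D.

Lemma der_add p q : D (p + q) = D p + D q.
Proof. by case: derD => L _; rewrite -[p]scale1r L !scale1r. Qed.

Lemma der0 : D 0 = 0.
Proof. by apply: (addrI (D 0)); rewrite -der_add !addr0. Qed.

Lemma der_scale c p : D (c *: p) = c *: D p.
Proof. by case: (derD) => L _; rewrite -[c *: p]addr0 L der0 addr0. Qed.

Lemma derC c : D c%:MP = 0.
Proof.
case: (derD) => _ M; rewrite -[c%:MP]mulr1 mul_mpolyC der_scale.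
suff -> : D 1 = 0 by rewrite scaler0.
by apply: (addrI (D 1)); rewrite addr0 -{3}[1]mulr1 M mulr1 mul1r.
Qed.

Lemma der_sum I r (F : I -> {mpoly R[n]}) :
  D (\sum_(i <- r) F i) = \sum_(i <- r) D (F i).
Proof. exact: (big_morph D der_add der0). Qed.

Lemma iter_der_ge p k l : (k <= l)%N -> iter k D p = 0 -> iter l D p = 0.
Proof.
by move=> /subnK <- E; rewrite iterD E; elim: (_ - _)%N => //= m ->; exact: der0.
Qed.

Lemma iter_scale_der f l p : D f = 0 -> iter l (scale_der f D) p = f ^+ l * iter l D p.
Proof.
move=> Df; case: (derD) => _ M; have DX k : D (f ^+ k) = 0.
  by elim: k => [|k IH]; rewrite ?expr0 -?mpolyC1 ?derC // exprS M Df IH mulr0 mul0r addr0.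
by elim: l => [|l IH] /=; rewrite ?expr0 ?mul1r // IH /scale_der M DX mul0r addr0 exprS mulrA.
Qed.

End Derivation.

Lemma LND_scale_der D f : is_LND D -> D f = 0 -> is_LND (scale_der f D).
Proof.
move=> [derD nilD] Df; split.
  split=> [c p q | p q]; rewrite /scale_der.
    by rewrite (der_add derD) (der_scale derD) mulrDr scalerAr.
  by case: derD => _ ->; ring.
by move=> p; have [k E] := nilD p; exists k; rewrite iter_scale_der // E mulr0.
Qed.

(* The coefficient sequence of [exp (tD) p], a polynomial in the time variable [t]. *)
Definition exp_poly D p : {poly {mpoly R[n]}} :=
  \poly_(l < nil_index D p) (l`!%:R^-1 *: iter l D p).

Section LocallyNilpotent.

Variable D : {mpoly R[n]} -> {mpoly R[n]}.
Hypothesis HD : is_LND D.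
Let derD : is_Rderivation D := proj1 HD.

(** The index chosen by [epsilon] is a true nilpotency index, so the terms cut off are zero. *)
Lemma coef_exp_poly p l : (exp_poly D p)`_l = l`!%:R^-1 *: iter l D p.
Proof.
rewrite coef_poly; case: ltnP => // le_l.
rewrite (iter_der_ge derD le_l) ?scaler0 //.
exact: (epsilon_spec (inhabits 0%N) (fun k => iter k D p = 0) (proj2 HD p)).
Qed.

Lemma expD_horner p : expD D p = (exp_poly D p).[1].
Proof. by rewrite horner_poly; apply: eq_bigr => l _; rewrite expr1n mulr1. Qed.

Lemma expD_linear c p q : expD D (c *: p + q) = c *: expD D p + expD D q.
Proof.
rewrite !expD_horner.
suff -> : exp_poly D (c *: p + q) = (c%:MP)%:P * exp_poly D p + exp_poly D q.
  by rewrite hornerD hornerM hornerC mul_mpolyC.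
apply/polyP => l; rewrite coefD coefCM !coef_exp_poly mul_mpolyC.
rewrite scalerA mulrC -scalerA -scalerDr; congr (_ *: _).
by elim: l => //= l ->; rewrite (der_add derD) (der_scale derD).
Qed.

(* [t |-> exp (tD) p] is the only solution of [T' = D T] with [T(0) = p]. *)
Lemma exp_poly_unique (T : {poly {mpoly R[n]}}) p : T`_0 = p ->
  (forall l, T`_l.+1 *+ l.+1 = D T`_l) -> T = exp_poly D p.
Proof.
move=> T0 TS; apply/polyP; elim=> [|l IH]; rewrite coef_exp_poly.
  by rewrite invr1 scale1r T0.
have fact_unit : l`!%:R \is a @GRing.unit R by rewrite -[l`!]prednK ?fact_gt0.
rewrite -[LHS]scale1r -{1}(mulVr (HQ l)) -scalerA scaler_nat TS IH coef_exp_poly (der_scale derD).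
by rewrite scalerA factS natrM invrM // mulrC.
Qed.

Lemma exp_polyS p l : (exp_poly D p)`_l.+1 *+ l.+1 = D (exp_poly D p)`_l.
Proof.
rewrite !coef_exp_poly (der_scale derD) -scaler_nat scalerA factS natrM.
have fact_unit : l`!%:R \is a @GRing.unit R by rewrite -[l`!]prednK ?fact_gt0.
by rewrite invrM // mulrCA divrr ?mulr1.
Qed.

(** By the Leibniz rule the product solves the same differential equation with initial value
    [p * q]; uniqueness replaces a binomial computation. *)
Lemma exp_polyM p q : exp_poly D (p * q) = exp_poly D p * exp_poly D q.
Proof.
apply/esym/exp_poly_unique => [|l].
  by rewrite coefM big_ord1 !coef_exp_poly invr1 !scale1r.
rewrite -coef_deriv derivM coefD !coefM (der_sum derD) -big_split /=.
apply: eq_bigr => i _; rewrite !coef_deriv !exp_polyS.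
by case: derD => _ ->; rewrite addrC.
Qed.

Lemma expD_alg_map : alg_map (expD D).
Proof.
split=> [|p q|]; first exact: expD_linear.
  by rewrite !expD_horner exp_polyM hornerM.
rewrite expD_horner -(_ : 1%:P = exp_poly D 1) ?hornerC //.
apply: exp_poly_unique => [|l]; rewrite !coefC //= mul0rn.
by case: eqP => _; rewrite ?(der0 derD) // -mpolyC1 (derC derD).
Qed.

Lemma expD_quadratic p : iter 3 D p = 0 -> expD D p = p + D p + 2%:R^-1 *: D (D p).
Proof.
move=> D3; rewrite expD_horner; have -> : exp_poly D p = \poly_(l < 3) (l`!%:R^-1 *: iter l D p).
  apply/polyP => l; rewrite coef_exp_poly coef_poly; case: ltnP => // l3.
  by rewrite (iter_der_ge derD l3) ?scaler0.
rewrite horner_poly !big_ord_recl big_ord0 /= !expr1n !mulr1 addr0 invr1 !scale1r.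
by rewrite addrA.
Qed.

End LocallyNilpotent.

End Exponential.

(** * Affine derivations *)

Section AffineDerivation.

Variable R : idomainType.
Local Notation P := {mpoly R[2]}.
Local Notation x0 := ('X_ord0 : P).
Local Notation x1 := ('X_ord_max : P).

Lemma linX a b e (k : 'I_2) : (lin a b e x0 x1)@_(U_(k)) = 
  a *+ (ord0 == k) + b *+ (ord_max == k).
Proof.
by rewrite /lin !mcoeffD !mcoeffZ !mcoeffXU mcoeffC mnm1_eq0 mulr0 addr0 !mulr_natr.
Qed.

Lemma lin_inj a b e a' b' e' :
  lin a b e x0 x1 = lin a' b' e' x0 x1 -> [/\ a = a', b = b' & e = e'].
Proof.
move=> E; have E0 := congr1 (mcoeff U_(ord0)) E; have E1 := congr1 (mcoeff U_(ord_max)) E.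
move: E0 E1; rewrite !linX /= !(mulr0n, mulr1n, addr0, add0r) => Ea Eb; split=> //.
have := congr1 (mcoeff 0%MM) E; rewrite /lin Ea Eb !mcoeffD !mcoeffC eqxx !mulr1.
exact: addrI.
Qed.

Lemma lin0 e : lin 0 0 e x0 x1 = e%:MP.
Proof. by rewrite /lin !scale0r !add0r. Qed.

Lemma lin_eq0 a b e : lin a b e x0 x1 = 0 -> [/\ a = 0, b = 0 & e = 0].
Proof. by rewrite -mpolyC0 -lin0 => /lin_inj. Qed.

Lemma msize_lin_X a b e : (msize (lin a b e x0 x1) <= 2)%N.
Proof. by apply: msize_lin_le; rewrite ?msizeX ?mdeg1. Qed.

Lemma msize_lin_le1 a b e : (msize (lin a b e x0 x1) <= 1)%N -> a = 0 /\ b = 0.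
Proof.
by move=> /msize1_polyC; rewrite -lin0 => /lin_inj [].
Qed.

Lemma linear_aut a b c d w : w * (a * d - b * c) = 1 ->
  exists phi phi', [/\ affine_aut phi, cancel phi phi', cancel phi' phi,
    phi x0 = lin a b 0 x0 x1 & phi x1 = lin c d 0 x0 x1].
Proof.
move=> Hw.
pose sub (F G : P) (p : P) := p \mPo [tuple F; G].
have subA F G : alg_map (sub F G).
  by split=> [u p q | p q |]; rewrite /sub ?comp_mpolyD ?comp_mpolyZ // ?rmorphM ?rmorph1.
have sub0 F G : sub F G x0 = F by rewrite /sub comp_mpolyXU.
have sub1 F G : sub F G x1 = G by rewrite /sub comp_mpolyXU.
have E := det_monomial Hw.
have : (w * a * d)%:MP_[2] = (1 + w * b * c)%:MP by rewrite E.
rewrite !(mpolyCD, mpolyCM) => E'.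
pose phi := sub (lin a b 0 x0 x1) (lin c d 0 x0 x1).
pose phi' := sub (lin (w * d) (- (w * b)) 0 x0 x1) (lin (- (w * c)) (w * a) 0 x0 x1).
have idA : alg_map (id : P -> P) by split.
have K : cancel phi phi'.
  apply: (alg_map_eq (alg_map_comp (subA _ _) (subA _ _)) idA) => i /=.
  case: (ord2P i) => ->; rewrite ?sub0 ?sub1 (alg_map_lin _ _ _ _ _ (subA _ _)) sub0 sub1;
    by rewrite /lin -!mul_mpolyC !(mpolyCN, mpolyCM); ring: E'.
have K' : cancel phi' phi.
  apply: (alg_map_eq (alg_map_comp (subA _ _) (subA _ _)) idA) => i /=.
  case: (ord2P i) => ->; rewrite ?sub0 ?sub1 (alg_map_lin _ _ _ _ _ (subA _ _)) sub0 sub1;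
    by rewrite /lin -!mul_mpolyC !(mpolyCN, mpolyCM); ring: E'.
exists phi, phi'; split=> //; [| by rewrite /phi sub0 | by rewrite /phi sub1].
have [L M one] := subA (lin a b 0 x0 x1) (lin c d 0 x0 x1).
have autphi : is_Raut phi by split=> //; exists phi'.
split=> // i; apply/eqP; rewrite eqn_leq; apply/andP; split.
  by case: (ord2P i) => ->; rewrite /phi ?sub0 ?sub1 msize_lin_X.
(* An affine automorphism needs images of degree exactly 1; the lower bound comes from
   bijectivity. *)
exact: msize_Raut.
Qed.


Variable D : P -> P.
Hypothesis HD : is_LND D.
Let derD : is_Rderivation D := proj1 HD.

Lemma der_lin a b e F G : D (lin a b e F G) = lin a b 0 (D F) (D G).
Proof.
by rewrite /lin !(der_add derD) !(der_scale derD) (derC derD) mpolyC0.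
Qed.

Lemma lin_lin a b e c d g u v z (F G : P) :
  lin u v z (lin a b e F G) (lin c d g F G) =
  lin (u * a + v * c) (u * b + v * d) (u * e + v * g + z) F G.
Proof. by rewrite /lin -!mul_mpolyC; ring. Qed.

(** * Linear part A with rows [(a, b)] and [(c, d)], translation vector [(e, g)] *)

Section Coefficients.

Variables a b c d e g : R.
Hypothesis D0 : D x0 = lin a b e x0 x1.
Hypothesis D1 : D x1 = lin c d g x0 x1.

Lemma der_lin_X u v z : D (lin u v z x0 x1) =
  lin (u * a + v * c) (u * b + v * d) (u * e + v * g) x0 x1.
Proof. by rewrite der_lin D0 D1 lin_lin addr0. Qed.

Lemma iter_vanish : exists k, iter k D x0 = 0 /\ iter k D x1 = 0.
Proof.
case: (HD) => _ nilD; have [[k Ek] [l El]] := (nilD x0, nilD x1).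
by exists (k + l)%N; split;
  [apply: iter_der_ge Ek | apply: iter_der_ge El]; rewrite ?leq_addr ?leq_addl.
Qed.

(** The linear part of the k-th iterate is the k-th power of A, with determinant the k-th power of
    det A, and some iterate kills both variables. *)
Lemma det_eq0 : a * d - b * c = 0.
Proof.
have iterE k : exists u v z u' v' z', [/\ iter k D x0 = lin u v z x0 x1,
    iter k D x1 = lin u' v' z' x0 x1 & u * v' - v * u' = (a * d - b * c) ^+ k].
  elim: k => [|k [u [v [z [u' [v' [z' [/= -> -> E]]]]]]]].
    exists 1, 0, 0, 0, 1, 0; rewrite /lin !scale0r !scale1r mpolyC0 !(addr0, add0r).
    by split=> //; ring.
  do 6 eexists; rewrite !der_lin_X; split; [reflexivity | reflexivity |].
  by rewrite exprS -E; ring.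
have [k [E0 E1]] := iter_vanish.
have [u [v [z [u' [v' [z' [I0 I1 E]]]]]]] := iterE k.
move: E; rewrite I0 in E0; have [-> -> _] := lin_eq0 E0.
by rewrite !mul0r subrr => /esym/eqP; rewrite expf_eq0 => /andP [_ /eqP].
Qed.

(** Since det A = 0, Cayley-Hamilton makes each power of A a power of the trace times A. Were the
    trace nonzero, nilpotency would give [a = d = 0], a contradiction. *)
Lemma trace_eq0 : a + d = 0.
Proof.
have det0 := det_eq0.
have E : a * d = b * c by apply/eqP; rewrite -subr_eq0 det0.
have iterE k : exists z z', iter k.+1 D x0 = lin ((a + d) ^+ k * a) ((a + d) ^+ k * b) z x0 x1
    /\ iter k.+1 D x1 = lin ((a + d) ^+ k * c) ((a + d) ^+ k * d) z' x0 x1.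
  elim: k => [|k [z [z' [I0 I1]]]]; first by exists e, g; rewrite /= D0 D1 expr0 !mul1r.
  rewrite [iter k.+2 D x0]iterS [iter k.+2 D x1]iterS I0 I1 !der_lin_X.
  by do 2 eexists; split; congr lin; rewrite exprS; ring: E.
have [k [E0 E1]] := iter_vanish.
have := iterE k => -[z [z' []]]; rewrite !iterS E0 E1 !(der0 derD).
move=> /esym/lin_eq0 [/eqP Ea _ _] /esym/lin_eq0 [_ /eqP Ed _].
have [// | t0] := eqVneq (a + d) 0.
move: Ea Ed; rewrite !mulf_eq0 expf_eq0 (negPf t0) andbF /= => /eqP -> /eqP ->.
by rewrite addr0.
Qed.

(** Trace and determinant vanish, so A squares to zero and only A applied to the translation vector
    is left. *)
Lemma der_der0 : D (D x0) = (a * e + b * g)%:MP.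
Proof.
have det0 := det_eq0; have tr0 := trace_eq0.
rewrite D0 der_lin_X -lin0; congr lin.
  by transitivity (a * (a + d) - (a * d - b * c)); [ring | rewrite det0 tr0 mulr0 subrr].
by transitivity (b * (a + d)); [ring | rewrite tr0 mulr0].
Qed.

Lemma der_der1 : D (D x1) = (c * e + d * g)%:MP.
Proof.
have det0 := det_eq0; have tr0 := trace_eq0.
rewrite D1 der_lin_X -lin0; congr lin.
  by transitivity (c * (a + d)); [ring | rewrite tr0 mulr0].
by transitivity (d * (a + d) - (a * d - b * c)); [ring | rewrite det0 tr0 mulr0 subrr].
Qed.

Lemma der3_X i : iter 3 D 'X_i = 0.
Proof. by case: (ord2P i) => -> /=; rewrite ?der_der0 ?der_der1 (derC derD). Qed.

(** The row [(u, v)] annihilates the 2 by 3 matrix formed by A and the translation vector. As A has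
    trace 0, the two scalars are, up to sign, minors of that matrix, so both kill [u] and [v]. *)
Lemma kernel_affine u v z : D (lin u v z x0 x1) = 0 ->
  a * e + b * g != 0 \/ c * e + d * g != 0 -> u = 0 /\ v = 0.
Proof.
rewrite der_lin_X => /lin_eq0 [E1 E2 E3] s0.
have tr0 := trace_eq0; have Ed : d = - a by apply/eqP; rewrite -addr_eq0 addrC tr0.
have U0 : u * (a * e + b * g) = 0.
  transitivity (a * (u * e + v * g) + g * (u * b + v * d)); first by rewrite Ed; ring.
  by rewrite E2 E3 !mulr0 addr0.
have V0 : v * (a * e + b * g) = 0.
  transitivity (- e * (u * b + v * d) + b * (u * e + v * g)); first by rewrite Ed; ring.
  by rewrite E2 E3 !mulr0 addr0.
have U1 : u * (c * e + d * g) = 0.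
  transitivity (c * (u * e + v * g) - g * (u * a + v * c)); first by rewrite Ed; ring.
  by rewrite E1 E3 !mulr0 subr0.
have V1 : v * (c * e + d * g) = 0.
  transitivity (e * (u * a + v * c) - a * (u * e + v * g)); first by rewrite Ed; ring.
  by rewrite E1 E3 !mulr0 subr0.
by case: s0 => /negPf s0; split; apply/eqP; move/eqP: U0; move/eqP: V0;
  move/eqP: U1; move/eqP: V1; rewrite !mulf_eq0 s0 ?orbF.
Qed.

(** The form with row [(u, v)] has constant image under [D] and becomes the first coordinate. Trace
    0 makes the linear part of the image of the second one proportional to [(u, v)]. *)
Lemma triangularizable (u v u' v' w : R) : w * (u * v' - v * u') = 1 ->
  u * a + v * c = 0 -> u * b + v * d = 0 ->
  exists psi psi', [/\ Aff psi, cancel psi psi', cancel psi' psi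
    & triangular_der (psi' \o D \o psi)].
Proof.
move=> Hw Ea Eb; have tr0 := trace_eq0.
have [psi [psi' [aff K K' P0 P1]]] := linear_aut Hw.
exists psi, psi'; split=> //.
  by apply: gen_ext (gen_mul aff (gen_id _)) _ => p.
have [/Raut_alg_map psiA _] := aff.
have psi'A := alg_map_cancel psiA K K'.
have Q0 : psi' (D (psi x0)) = (u * e + v * g)%:MP.
  by rewrite P0 der_lin_X Ea Eb lin0 (alg_mapC psi'A).
have Ed : d = - a by apply/eqP; rewrite -addr_eq0 addrC tr0.
pose p := u' * a + v' * c; pose q := u' * b + v' * d.
have Epq : u * q = v * p.
  apply/eqP; rewrite -subr_eq0; apply/eqP.
  transitivity (u' * (u * b + v * d) - v' * (u * a + v * c)); first by rewrite /p /q Ed; ring.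
  by rewrite Ea Eb !mulr0 subrr.
have [k Q1] : exists k, psi' (D (psi x1)) = lin k 0 (u' * e + v' * g) x0 x1.
  (* Cramer's rule gives the coefficient of [(p, q)] along [(u, v)]; the one along [(u', v')] is
     zero by [Epq]. *)
  exists (w * (p * v' - q * u')); apply: (can_inj K); rewrite K'.
  rewrite (alg_map_lin _ _ _ _ _ psiA) P0 P1 der_lin_X lin_lin !mul0r !mulr0 !addr0 add0r.
  rewrite -/p -/q; congr lin.
    transitivity (w * (u * v' - v * u') * p); first by rewrite Hw mul1r.
    by transitivity (w * (p * v' * u - u' * (v * p))); [ring | rewrite -Epq; ring].
  transitivity (w * (u * v' - v * u') * q); first by rewrite Hw mul1r.
  by transitivity (w * ((u * q) * v' - u' * v * q)); [ring | rewrite Epq; ring].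
move=> i j le_ij m; rewrite mcoeff_msupp.
case: (ord2P i) (ord2P j) le_ij => -> [] -> //= _; rewrite ?Q0 ?Q1 /lin.
- by rewrite mcoeffC; case: (m =P 0%MM) => [-> | _]; rewrite ?mnm0E // mulr0 eqxx.
- by rewrite mcoeffC; case: (m =P 0%MM) => [-> | _]; rewrite ?mnm0E // mulr0 eqxx.
rewrite scale0r addr0 mcoeffD mcoeffZ mcoeffX mcoeffC.
case: (U_(ord0)%MM =P m) => [<- | _]; first by rewrite mnm1E.
by case: (m =P 0%MM) => [-> | _]; rewrite ?mnm0E // !mulr0 addr0 eqxx.
Qed.

End Coefficients.

End AffineDerivation.

(** * Exponentials of affine derivations *)

Section ExpAffine.

Variable R : idomainType.
Hypothesis HQ : Qdomain R.
Local Notation P := {mpoly R[2]}.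
Local Notation x0 := ('X_ord0 : P).
Local Notation x1 := ('X_ord_max : P).

Variable D : P -> P.
Hypothesis HD : is_LND D.
Let derD : is_Rderivation D := proj1 HD.

Lemma expD_scale f p : D f = 0 -> iter 3 D p = 0 ->
  expD (scale_der f D) p = p + f * D p + 2%:R^-1 *: (f ^+ 2 * D (D p)).
Proof.
move=> Df D3; have fDA := LND_scale_der HD Df.
have E l := iter_scale_der derD l p Df.
rewrite expD_quadratic //; last by rewrite E D3 mulr0.
by congr (_ + _ *: _); rewrite -/(iter 2 (scale_der f D) p) E.
Qed.

(** On a variable both series stop after the square term, and what is left over has the factor 1/2 +
    1/2 - 1. *)
Lemma expD_const_cancel c : (forall i, iter 3 D 'X_i = 0) ->
  cancel (expD (scale_der c%:MP D)) (expD (scale_der (- c)%:MP D)).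
Proof.
move=> D3; have expA k : alg_map (expD (scale_der k%:MP D)).
  by apply: expD_alg_map => //; apply: LND_scale_der; rewrite ?(derC derD).
have idA : alg_map (id : P -> P) by split.
apply: (alg_map_eq (alg_map_comp (expA _) (expA _)) idA) => i /=.
have D3i : D (D (D 'X_i)) = 0 := D3 i.
rewrite (expD_scale (derC derD c) (D3 i)) expr2 -mpolyCM !mul_mpolyC.
rewrite !(alg_mapD (expA _)) !(alg_mapZ (expA _)).
rewrite !expD_scale ?(derC derD) ?D3i //= ?D3i ?(der0 derD) //.
rewrite !mulr0 !scaler0 !addr0 expr2 -mpolyCM !mul_mpolyC mulrNN.
have two : (2 : R) * 2%:R^-1 = 1 by rewrite divrr // (HQ 1).
have {}two : (2%:R^-1 + 2%:R^-1 : R) = 1 by move: two; rewrite mulr_natl mulr2n.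
rewrite -!mul_mpolyC !(mpolyCN, mpolyCM).
have two' : (2%:R^-1)%:MP_[2] + (2%:R^-1)%:MP = (1 : P) by rewrite -mpolyCD two.
set h := (_^-1)%:MP in two' *; set y := D (D _).
transitivity ('X_i + (h + h - 1) * c%:MP * c%:MP * y); first by ring.
by rewrite two' subrr !mul0r addr0.
Qed.

Hypothesis Haff : affine_der D.

Lemma affine_coefs : exists a b c d e g,
  D x0 = lin a b e x0 x1 /\ D x1 = lin c d g x0 x1.
Proof.
have [a [b [e E0]]] := lin_le2E (Haff ord0).
have [c [d [g E1]]] := lin_le2E (Haff ord_max).
by exists a, b, c, d, e, g.
Qed.

Lemma affine_der3 i : iter 3 D 'X_i = 0.
Proof.
by have [a [b [c [d [e [g [D0 D1]]]]]]] := affine_coefs; apply: der3_X D0 D1 i.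
Qed.

Lemma affine_der2 i : exists s, D (D 'X_i) = s%:MP.
Proof.
have [a [b [c [d [e [g [D0 D1]]]]]]] := affine_coefs.
by case: (ord2P i) => ->; eexists; [apply: der_der0 D0 D1 | apply: der_der1 D0 D1].
Qed.

Lemma expD_const_affine c : affine_aut (expD (scale_der c%:MP D)).
Proof.
have expA : alg_map (expD (scale_der c%:MP D)).
  by apply: expD_alg_map => //; apply: LND_scale_der; rewrite ?(derC derD).
have aut : is_Raut (expD (scale_der c%:MP D)).
  case: expA => L M one; split=> //; exists (expD (scale_der (- c)%:MP D)).
    exact: expD_const_cancel affine_der3.
  rewrite -{2}[c]opprK; exact: expD_const_cancel affine_der3.
split=> // i; apply/eqP; rewrite eqn_leq msize_Raut // andbT.
have [s Es] := affine_der2 i.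
rewrite (expD_scale (derC derD c) (affine_der3 i)) Es expr2 -!mpolyCM mul_mpolyC.
rewrite -[_ *: _%:MP]mul_mpolyC -mpolyCM.
apply: leq_trans (msizeD_le _ _) _; rewrite geq_max msizeC; apply/andP; split; last first.
  by case: (_ != 0).
apply: leq_trans (msizeD_le _ _) _; rewrite geq_max msizeX mdeg1 /=.
exact: leq_trans (msizeZ_le _ _) (Haff i).
Qed.

Lemma msize_sqr (f : P) : (2 <= msize f)%N -> msize (f ^+ 2) = (2 * (msize f).-1).+1.
Proof.
move=> f2; have f0 : f != 0 by rewrite -msize_poly_eq0 -lt0n; apply: leq_trans f2.
rewrite expr2 msizeM //; move: (msize f) f2 => m m2; lia.
Qed.

(** * Degrees of [y + f * l + t *: f ^+ 2] for [y] and [l] of degree at most 1 *)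

Section Nonconstant.

Variables (f y l : P) (t : R).
Hypotheses (f_ge2 : (2 <= msize f)%N) (y_le2 : (msize y <= 2)%N) (l_le2 : (msize l <= 2)%N).

Let f0 : f != 0.
Proof. by rewrite -msize_poly_eq0 -lt0n; apply: leq_trans f_ge2. Qed.

Lemma msize_shift_le : (msize (y + f * l) <= (msize f).+1)%N.
Proof.
apply: leq_trans (msizeD_le _ _) _; rewrite geq_max; apply/andP; split.
  by apply: leq_trans y_le2 _; apply: leq_trans f_ge2 _.
have [-> | l0] := eqVneq l 0; first by rewrite mulr0 msize0.
rewrite msizeM //; move: (msize f) (msize l) l_le2 => m k k2; lia.
Qed.

Lemma msize_shift : (2 <= msize l)%N -> msize (y + f * l) = (msize f).+1.
Proof.
move=> l2; have {l2} l2 : msize l = 2%N by apply/eqP; rewrite eqn_leq l_le2 l2.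
have l0 : l != 0 by rewrite -msize_poly_eq0 l2.
have E : msize (f * l) = (msize f).+1 by rewrite msizeM // l2 addn2.
by rewrite addrC msizeD_small E //; apply: leq_ltn_trans y_le2 _.
Qed.

(** For deg f at least 2 the degree 2 deg f of the square exceeds 1 + deg f, so the square
    dominates. *)
Lemma msize_shift_quadratic : t != 0 -> (3 <= msize f)%N ->
  msize (y + f * l + t *: f ^+ 2) = (2 * (msize f).-1).+1.
Proof.
move=> t0 f3; rewrite addrC msizeD_small msizeZ ?msize_sqr //.
apply: leq_ltn_trans msize_shift_le _; move: (msize f) f3 => m m3; lia.
Qed.

End Nonconstant.

Lemma msize_shift_quadratic_le (f y l : P) t : (3 <= msize f)%N -> (msize y <= 2)%N ->
  (msize l <= 2)%N -> (msize (y + f * l + t *: f ^+ 2) <= (2 * (msize f).-1).+1)%N.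
Proof.
move=> f3 y2 l2; have f2 := ltnW f3.
apply: leq_trans (msizeD_le _ _) _; rewrite geq_max; apply/andP; split.
  apply: leq_trans (msize_shift_le f2 y2 l2) _; move: (msize f) f3 => m m3; lia.
by apply: leq_trans (msizeZ_le _ _) _; rewrite msize_sqr.
Qed.

Lemma Tame_exp_triangularizable f : D f = 0 -> (2 <= msize f)%N ->
  Tame (expD (scale_der f D)) ->
  exists psi psi', [/\ Aff psi, cancel psi psi', cancel psi' psi
    & triangular_der (psi' \o D \o psi)].
Proof.
move=> Df f2 /(Tame_degree HQ).
have [a [b [c [d [e [g [D0 D1]]]]]]] := affine_coefs.
set F0 := expD _ x0; set F1 := expD _ x1.
have half : (2%:R^-1 : R) != 0.
  by apply: contraTneq (HQ 1) => E; rewrite -[_%:R]invrK E invr0 unitr0.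
set s0 := a * e + b * g; set s1 := c * e + d * g.
have F0E : F0 = x0 + f * D x0 + (2%:R^-1 * s0) *: f ^+ 2.
  rewrite /F0 expD_scale //; last exact: affine_der3.
  by rewrite (der_der0 HD D0 D1) -/s0 [_ * s0%:MP]mulrC mul_mpolyC scalerA.
have F1E : F1 = x1 + f * D x1 + (2%:R^-1 * s1) *: f ^+ 2.
  rewrite /F1 expD_scale //; last exact: affine_der3.
  by rewrite (der_der1 HD D0 D1) -/s1 [_ * s1%:MP]mulrC mul_mpolyC scalerA.
(* Combinations of the images keep the shape of the images, so the same degree estimates apply to
   them. *)
have linF u v z : lin u v z F0 F1 = lin u v z x0 x1 + f * D (lin u v z x0 x1)
    + (2%:R^-1 * (u * s0 + v * s1)) *: f ^+ 2.
  by rewrite (der_lin HD) F0E F1E /lin mpolyC0 -!mul_mpolyC !(mpolyCM, mpolyCD); ring.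
have der_le2 u v z : (msize (D (lin u v z x0 x1)) <= 2)%N.
  by rewrite (der_lin_X HD D0 D1) msize_lin_X.
have X0_le2 : (msize x0 <= 2)%N by rewrite msizeX mdeg1.
have X1_le2 : (msize x1 <= 2)%N by rewrite msizeX mdeg1.
have D0_le2 := Haff ord0; have D1_le2 := Haff ord_max.
have [/andP [/eqP s00 /eqP s10] | s_neq0] := boolP ((s0 == 0) && (s1 == 0)).
- (* [exp (fD) x_i = x_i + f D x_i], with leading form that of [f D x_i] *)
  have [A0 _ | A0] := boolP [&& a == 0, b == 0, c == 0 & d == 0].
    (* If A = 0, every row annihilates it and the identity change of coordinates serves. *)
    case/and4P: A0 => /eqP a0 /eqP b0 /eqP c0 /eqP d0.
    by apply: (triangularizable HD D0 D1 (u := 1) (v := 0) (u' := 0) (v' := 1) (w := 1));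
      rewrite ?a0 ?b0 ?c0 ?d0; ring.
  rewrite s00 mulr0 scale0r addr0 in F0E; rewrite s10 mulr0 scale0r addr0 in F1E.
  have F0_le : (msize F0 <= (msize f).+1)%N by rewrite F0E; apply: msize_shift_le.
  have F1_le : (msize F1 <= (msize f).+1)%N by rewrite F1E; apply: msize_shift_le.
  have big : ((msize f).+1 <= maxn (msize F0) (msize F1))%N.
    rewrite leq_max; apply: contraNT A0; rewrite negb_or -!ltnNge => /andP [lt0 lt1].
    have [D0_ge2 | D0_le1] := leqP 2 (msize (D x0)).
      by move: lt0; rewrite F0E msize_shift // ltnn.
    have [D1_ge2 | D1_le1] := leqP 2 (msize (D x1)).
      by move: lt1; rewrite F1E msize_shift // ltnn.
    move: D0_le1 D1_le1; rewrite D0 D1 => /msize_lin_le1 [-> ->] /msize_lin_le1 [-> ->].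
    by rewrite eqxx.
  case=> [[F0_le2 F1_le2] | [u [v [u' [v' [z [w [Hw lt]]]]]]]].
    have : (maxn (msize F0) (msize F1) <= 2)%N by rewrite geq_max F0_le2.
    by move=> /(leq_trans big); rewrite ltnNge f2.
  have {}lt : (msize (lin u v z F0 F1) < (msize f).+1)%N.
    by apply: leq_trans lt _; rewrite geq_max F0_le.
  (* If this derivative were nonconstant, [f] times it would have the full degree and there would be
     no drop; being constant means that [(u, v)] annihilates A. *)
  have Du : (msize (D (lin u v z x0 x1)) <= 1)%N.
    rewrite leqNgt; apply/negP => ge2; move: lt.
    by rewrite linF s00 s10 !mulr0 addr0 mulr0 scale0r addr0 msize_shift ?msize_lin_X // ltnn.
  move: Du; rewrite (der_lin_X HD D0 D1) => /msize_lin_le1 [Ea Eb].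
  exact: (triangularizable HD D0 D1 Hw Ea Eb).
(* Here the leading form of [exp (fD) x_i] is that of [f^2 D^2 x_i / 2]. *)
have s_or : s0 != 0 \/ s1 != 0 by move: s_neq0; rewrite negb_and => /orP.
have f3 : (3 <= msize f)%N.
  rewrite ltnNge; apply/negP => f_le2; have [u [v [z fE]]] := lin_le2E f_le2.
  rewrite fE in Df f2; have [u0 v0] := kernel_affine HD D0 D1 Df s_or.
  by move: f2; rewrite u0 v0 lin0 msizeC; case: (_ != 0).
have F0_le : (msize F0 <= (2 * (msize f).-1).+1)%N.
  by rewrite F0E; apply: msize_shift_quadratic_le.
have F1_le : (msize F1 <= (2 * (msize f).-1).+1)%N.
  by rewrite F1E; apply: msize_shift_quadratic_le.
have big : ((2 * (msize f).-1).+1 <= maxn (msize F0) (msize F1))%N.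
  rewrite leq_max; case: s_or => s_n0.
    by rewrite F0E msize_shift_quadratic ?mulf_neq0 // leqnn.
  by rewrite F1E orbC msize_shift_quadratic ?mulf_neq0 // leqnn.
case=> [[F0_le2 F1_le2] | [u [v [u' [v' [z [w [Hw lt]]]]]]]].
  have : (maxn (msize F0) (msize F1) <= 2)%N by rewrite geq_max F0_le2.
  by move=> /(leq_trans big); move: (msize f) f3 => m m3; lia.
have {}lt : (msize (lin u v z F0 F1) < (2 * (msize f).-1).+1)%N.
  by apply: leq_trans lt _; rewrite geq_max F0_le.
(* The drop of degree forces the coefficient of [f ^+ 2] to vanish. *)
have us0 : u * s0 + v * s1 = 0.
  apply/eqP; apply: contraTT lt => us_n0; rewrite -leqNgt linF.
  by rewrite msize_shift_quadratic ?mulf_neq0 ?msize_lin_X.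
(* Thus [D (lin u v z x0 x1)] is an affine form in the kernel, hence constant, and [(u, v)]
   annihilates A again. *)
have DD : D (D (lin u v z x0 x1)) = 0.
  by rewrite !(der_lin HD) (der_der0 HD D0 D1) (der_der1 HD D0 D1) /lin
    -!mul_mpolyC -!mpolyCM -!mpolyCD us0 addr0.
move: DD; rewrite (der_lin_X HD D0 D1) => /(kernel_affine HD D0 D1) /(_ s_or) [Ea Eb].
exact: (triangularizable HD D0 D1 Hw Ea Eb).
Qed.

End ExpAffine.

Theorem theorem3p3p1 (R : idomainType) (HQ : Qdomain R)
  (D : {mpoly R[2]} -> {mpoly R[2]})
  (HD : is_LND D) (Haff : affine_der D)
  (Hnt : forall psi psi' : {mpoly R[2]} -> {mpoly R[2]},
      Aff psi -> cancel psi psi' -> cancel psi' psi ->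
      ~ triangular_der (psi' \o D \o psi))
  (f : {mpoly R[2]}) (Hf : D f = 0) :
  Tame (expD (scale_der f D)) <-> exists c : R, f = c%:MP.
Proof.
split=> [tame_f | [c ->]].
  have [f_le1 | f_ge2] := leqP (msize f) 1.
    by exists f@_0%MM; apply: msize1_polyC.
  have [psi [psi' [aff K K' tri]]] := Tame_exp_triangularizable HQ HD Haff Hf f_ge2 tame_f.
  by case: (Hnt psi psi' aff K K' tri).
(* For constant [f] the exponential is itself affine, so it is a word of one letter. *)
apply: gen_ext (gen_mul (or_introl (expD_const_affine HQ HD Haff c)) (gen_id _)) _ => p.
by [].
Qed.
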